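(* Let $A$ be an arbitrary $K$-algebra over a field $K$ of characteristic zero and let $s\ge 1$. The following statements are equivalent. 1. There exist commuting locally nilpotent $K$-derivations $\delta_1,\ldots,\delta_s$ of the algebra $A$ and elements $x_1,\ldots,x_s\in A$ satisfying $\delta_i(x_j)=\delta_{ij}$ (the Kronecker delta) for all $1\le i,j\le s$. 2. The algebra $A$ is an iterated Ore extension $A=B[x_1;d_1]\cdots[x_s;d_s]$ such that $d_i(B)\subseteq B$ and $d_i(x_j)\in B$ for all $1\le i,j\le s$. If the first condition holds, then $A=A^\delta[x_1;d_1]\cdots[x_s;d_s]$ is an iterated Ore extension of the ring of invariants $A^\delta:=\bigcap_{i=1}^s\ker(\delta_i)$ such that $d_i=\mathrm{ad}(x_i)$, $[x_i,A^\delta]\subseteq A^\delta$ and $[x_i,x_j]\in A^\delta$ for all $i,j$. In particular, $A=\bigoplus_{\alpha\in\mathbb N^s}x^\alpha A^\delta=\bigoplus_{\alpha\in\mathbb N^s}A^\delta x^\alpha$ where $x^\alpha:=x_1^{\alpha_1}\cdots x_s^{\alpha_s}$, and $A=\bigcup_{i\ge 0}N_i$ where $N_i=\bigoplus_{|\alpha|\le i}x^\alpha A^\delta=\bigoplus_{|\alpha|\le i}A^\delta x^\alpha$ for $i\ge 0$.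
   Context: Algebras are associative, unital, not necessarily commutative; $\mathbb N=\{0,1,2,\ldots\}$. A $K$-derivation $\delta$ of $A$ is locally nilpotent if for each $a\in A$ there is $n$ with $\delta^n(a)=0$. For a ring $R$ and a derivation $d$ of $R$, the Ore extension $R[x;d]$ is the ring freely generated over $R$ by $x$ subject to $xr=rx+d(r)$, $r\in R$. Write $[a,b]=ab-ba$ and $\mathrm{ad}(a)(b)=[a,b]$. In an iterated Ore extension $B[x_1;d_1]\cdots[x_s;d_s]$ (of $K$-algebras) the derivation $d_i$ is the restriction of $\mathrm{ad}(x_i)$, and $d_i(x_j)$ means $[x_i,x_j]$ for all $i,j$. Given commuting locally nilpotent derivations $\delta_1,\ldots,\delta_s$ of $A$, put $\delta^\alpha:=\delta_1^{\alpha_1}\cdots\delta_s^{\alpha_s}$, $|\alpha|:=\alpha_1+\cdots+\alpha_s$, and $N_i:=\{a\in A\mid \delta^\alpha(a)=0 \text{ for all }\alpha\in\mathbb N^s\text{ with }|\alpha|>i\}$. *)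

(* Defs.v *)
From HB Require Import structures.
From mathcomp Require Import all_boot all_order all_algebra.
From mathcomp Require Import finmap.
From mathcomp Require Import all_classical.

Set Implicit Arguments.
Unset Strict Implicit.
Unset Printing Implicit Defensive.

Import GRing.Theory.
Local Open Scope classical_set_scope.
Local Open Scope ring_scope.

(* [algType K] imposes [1 != 0].  So that the zero algebra is allowed, a
   K-algebra is a ring A with a ring homomorphism from K to the centre of A;
   the scalar product of k and a is [alg_map A k * a]. *)
Record algebra (K : fieldType) := Algebra {
  alg_ring :> pzRingType;
  alg_map : {rmorphism K -> alg_ring};
  alg_map_central : forall k a, alg_map k * a = a * alg_map k
}.
Arguments alg_map {K} _.

Lemma in_alg_central (K : fieldType) (A : algType K) (k : K) (a : A) :
  in_alg A k * a = a * in_alg A k.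
Proof. by rewrite /= mulr_algl mulr_algr. Qed.

Definition algebra_of_algType (K : fieldType) (A : algType K) : algebra K :=
  @Algebra K A (in_alg A) (@in_alg_central K A).

Section Rings.
Variable A : pzRingType.
Implicit Types (R S : set A) (x : A) (d : A -> A).

Definition ad (a b : A) : A := a * b - b * a.

Definition subring R : Prop := GRing.subring_closed [in R].

Definition derivation_on R d : Prop :=
  [/\ forall a, R a -> R (d a),
      forall a b, R a -> R b -> d (a + b) = d a + d b
    & forall a b, R a -> R b -> d (a * b) = d a * b + a * d b].

Definition ring_hom_on R (T : pzRingType) (f : A -> T) : Prop :=
  [/\ f 1 = 1,
      forall a b, R a -> R b -> f (a + b) = f a + f b
    & forall a b, R a -> R b -> f (a * b) = f a * f b].

(* S = R[x; d] inside A.  The last clause is the universal property of the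
   ring generated over R by x subject to x r = r x + d(r), r in R: a pair
   (f : R -> T, t) satisfying these relations extends uniquely to S.  Only the
   values of f on R and of g on S matter. *)
Definition ore_extension R x d S : Prop :=
  [/\ subring R, subring S, R `<=` S, S x & derivation_on R d] /\
  (forall r, R r -> x * r = r * x + d r) /\
  (forall (T : pzRingType) (f : A -> T) (t : T),
      ring_hom_on R f ->
      (forall r, R r -> t * f r = f r * t + f (d r)) ->
      (exists g : A -> T,
          [/\ ring_hom_on S g, forall r, R r -> g r = f r & g x = t]) /\
      (forall g h : A -> T,
          ring_hom_on S g -> (forall r, R r -> g r = f r) -> g x = t ->
          ring_hom_on S h -> (forall r, R r -> h r = f r) -> h x = t ->
          forall a, S a -> g a = h a)).

End Rings.

Section Algebras.
Variables (K : fieldType) (A : algebra K) (s : nat).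
Implicit Types (B : set A) (x : 'I_s -> A) (delta : 'I_s -> A -> A).
Implicit Types (alpha : {ffun 'I_s -> nat}).

Definition subalgebra B : Prop :=
  subring B /\ forall k b, B b -> B (alg_map A k * b).

(* A = B[x_0; d_0]...[x_(s-1); d_(s-1)] with intermediate algebras
   C i = B[x_0; d_0]...[x_(i-1); d_(i-1)]; d_i is the restriction of ad(x_i)
   to C i. *)
Definition iterated_ore_extension B x : Prop :=
  exists C : nat -> set A,
    [/\ C 0%N = B,
        C s = [set: A],
        forall i, (i <= s)%N -> subalgebra (C i)
      & forall i : 'I_s, ore_extension (C i) (x i) (ad (x i)) (C i.+1)].

Definition K_derivation (d : A -> A) : Prop :=
  derivation_on [set: A] d /\
  forall (k : K) a, d (alg_map A k * a) = alg_map A k * d a.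

Definition locally_nilpotent (d : A -> A) : Prop :=
  forall a, exists n : nat, iter n d a = 0.

Definition commuting_lnd_with_dual_elements delta x : Prop :=
  [/\ forall i, K_derivation (delta i),
      forall i, locally_nilpotent (delta i),
      forall i j a, delta i (delta j a) = delta j (delta i a)
    & forall i j, delta i (x j) = (i == j)%:R].

Definition invariants delta : set A := \bigcap_i [set a | delta i a = 0].

Definition mdeg alpha : nat := (\sum_(i < s) alpha i)%N.

Definition monomial x alpha : A := \prod_(i < s) x i ^+ alpha i.

Definition delta_pow delta alpha : A -> A :=
  \big[comp/idfun]_(i < s) iter (alpha i) (delta i).

Definition N_ delta (i : nat) : set A :=
  [set a | forall alpha, (i < mdeg alpha)%N -> delta_pow delta alpha a = 0].

End Algebras.

(* W is the internal direct sum of the U i, i in D: each w in W has exactly one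
   expression as a finite sum of elements c i of U i, and such sums lie in W. *)
Definition direct_sum (V : zmodType) (I : choiceType) (D : set I)
    (U : I -> set V) (W : set V) : Prop :=
  let decomposition (w : V) (c : {fsfun I -> V with 0}) :=
    (forall i, i \in finsupp c -> D i /\ U i (c i)) /\
    w = \sum_(i <- finsupp c) c i in
  (forall w, W w -> exists! c, decomposition w c) /\
  (forall w c, decomposition w c -> W w).

(* Main.v *)
Require Import Defs.
From HB Require Import structures.
From mathcomp Require Import all_boot all_order all_algebra.
From mathcomp Require Import finmap.
From mathcomp Require Import all_classical.

Import GRing.Theory.
Local Open Scope classical_set_scope.
Local Open Scope ring_scope.

Set Implicit Arguments.
Unset Strict Implicit.
Unset Printing Implicit Defensive.

(* From derivations to Ore extensions: with C_n the intersection of the kernels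
   of delta_i, i >= n, one has C_n = C_{n+1} /\ ker delta_n, so that it suffices
   to treat one locally nilpotent delta with delta x = 1 on an algebra S.
   Subtracting delta^n(a) x^n / n! from a kills the top of the delta-string of
   a, which shows that S is generated by ker delta and x; r + a x = 0 with r in
   ker delta forces a = 0, which gives freeness.  The same argument with
   multi-indices and delta^b(x^a) = a! [a = b] for |b| >= |a| gives the
   decompositions of A and of the N_i.

   Conversely, a derivation delta with delta(B) = 0 and delta(x_j) = [i = j]
   is built along the tower: a |-> a + delta(a) eps into the dual numbers
   extends from C_n to C_{n+1} because delta commutes with ad(x_n) on C_n, which
   need only be checked on the generators B, x_0, ..., x_(n-1).  There it holds
   because [x_n, B] and [x_n, x_j] lie in B. *)

(** * Subrings as rings in their own right, and generators of Ore extensions *)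

Section Subrings.
Variable A : pzRingType.
Implicit Types (R S : set A).

Lemma subringP S : subring S <->
  [/\ S 1, forall a b, S a -> S b -> S (a - b)
    & forall a b, S a -> S b -> S (a * b)].
Proof.
split=> [[S1 SB SM]|[S1 SB SM]].
  split; first by move: S1; rewrite inE.
  - by move=> a b Sa Sb; have := SB a b; rewrite !inE; apply.
  - by move=> a b Sa Sb; have := SM a b; rewrite !inE; apply.
by split; rewrite ?inE // => a b; rewrite !inE; [apply: SB | apply: SM].
Qed.

Section Closure.
Variables (S : set A) (subS : subring S).

Lemma subring1 : S 1. Proof. by case/subringP: subS. Qed.

Lemma subringB a b : S a -> S b -> S (a - b).
Proof. by case/subringP: subS => _ + _; apply. Qed.

Lemma subringM a b : S a -> S b -> S (a * b).
Proof. by case/subringP: subS => _ _; apply. Qed.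

Lemma subring0 : S 0.
Proof. by rewrite -(subrr 1); apply: subringB; apply: subring1. Qed.

Lemma subringN a : S a -> S (- a).
Proof. by rewrite -sub0r; apply: subringB; apply: subring0. Qed.

Lemma subringD a b : S a -> S b -> S (a + b).
Proof. by move=> Sa Sb; rewrite -[b]opprK; apply/subringB/subringN. Qed.

(** The proof of [subring S] is an argument so that [subring_type] depends on it and its ring
    instance can recover the closure properties. *)
Definition subring_pred of subring S : {pred A} := [in S].

Record subring_type := SubringElt
  { subring_val :> A; _ : subring_val \in subring_pred subS }.

HB.instance Definition _ := [isSub for subring_val].
HB.instance Definition _ := [Choice of subring_type by <:].
HB.instance Definition _ :=
  GRing.SubChoice_isSubPzRing.Build A (subring_pred subS) subring_type subS.

Lemma subring_type_valP (a : subring_type) : S (\val a).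
Proof. by case: a => a /= + ; rewrite inE. Qed.

End Closure.

Lemma ad_mul (x a b : A) : ad x (a * b) = ad x a * b + a * ad x b.
Proof. by rewrite /ad mulrBl mulrBr !mulrA addrA subrK. Qed.

Lemma ad_add (x a b : A) : ad x (a + b) = ad x a + ad x b.
Proof. by rewrite /ad mulrDl mulrDr opprD addrACA. Qed.

Lemma ring_hom_on0 R (T : pzRingType) (f : A -> T) :
  subring R -> ring_hom_on R f -> f 0 = 0.
Proof.
move=> subR [_ fD _]; apply: (addrI (f 0)).
by rewrite -fD ?addr0 //; apply: subring0.
Qed.

Lemma ring_hom_onB R (T : pzRingType) (f : A -> T) a b :
  subring R -> ring_hom_on R f -> R a -> R b -> f (a - b) = f a - f b.
Proof.
move=> subR [_ fD _] Ra Rb; apply: (addIr (f b)).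
by rewrite -fD ?subrK //; apply: subringB.
Qed.

(* Apply the universal property to the target S' itself and compare the
   resulting endomorphism with the identity. *)
Lemma ore_extension_generated R x d S (S' : set A) :
  ore_extension R x d S -> subring S' -> R `<=` S' -> S' x -> S `<=` S'.
Proof.
move=> [[subR subS RS Sx [dR _ _]] [comm univ]] subS' RS' S'x a Sa.
pose f (r : A) : subring_type subS' := insubd 0 r.
have valf r : R r -> \val (f r) = r.
  by move=> Rr; rewrite insubdK //; apply/mem_set/RS'.
have valx : \val (insubd (0 : subring_type subS') x) = x.
  by rewrite insubdK //; apply/mem_set.
have [R1 [RD RM]] := (subring1 subR, (subringD subR, subringM subR)).
have [||[g [[g1 gD gM] gR gx]] _] := univ (subring_type subS') f (insubd 0 x).
- split=> [|b c Rb Rc|b c Rb Rc]; apply: val_inj.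
  + by rewrite rmorph1 valf.
  + by rewrite rmorphD /= !valf//; apply: RD.
  + by rewrite rmorphM /= !valf//; apply: RM.
- move=> r Rr; apply: val_inj; rewrite rmorphD !rmorphM /= valx !valf //.
    exact: comm.
  exact: dR.
have [||_ uniq] := univ A idfun x; [by split|exact: comm|].
suff e : \val (g a) = a by rewrite -e; apply: subring_type_valP.
apply: (uniq (fun a => \val (g a)) idfun) => //.
- split=> [|b c Sb Sc|b c Sb Sc].
  + by rewrite g1 rmorph1.
  + by rewrite gD // rmorphD.
  + by rewrite gM // rmorphM.
- by move=> r Rr; rewrite gR // valf.
- by rewrite gx.
Qed.

End Subrings.

(** * Dual numbers over a ring *)

Section DualNumbers.
Variable A : pzRingType.

(** The pair (a, b) stands for a + b eps with eps central and eps^2 = 0. The separate name avoids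
    the componentwise product on pairs. *)
Definition dual : Type := (A * A)%type.
HB.instance Definition _ := GRing.Zmodule.on dual.

Definition dual_one : dual := (1, 0).
Definition dual_mul (a b : dual) : dual := (a.1 * b.1, a.2 * b.1 + a.1 * b.2).

Lemma dual_mulA : associative dual_mul.
Proof.
by move=> a b c; congr pair; rewrite /= !(mulrA, mulrDl, mulrDr, addrA).
Qed.

Lemma dual_mul1r : left_id dual_one dual_mul.
Proof. by case=> a b; rewrite /dual_mul /= !mul1r mul0r add0r. Qed.

Lemma dual_mulr1 : right_id dual_one dual_mul.
Proof. by case=> a b; rewrite /dual_mul /= !mulr1 mulr0 addr0. Qed.

Lemma dual_mulDl : left_distributive dual_mul +%R.
Proof. by move=> a b c; congr pair; rewrite /= !mulrDl // addrACA. Qed.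

Lemma dual_mulDr : right_distributive dual_mul +%R.
Proof. by move=> a b c; congr pair; rewrite /= !mulrDr // addrACA. Qed.

HB.instance Definition _ := GRing.Zmodule_isPzRing.Build dual
  dual_mulA dual_mul1r dual_mulr1 dual_mulDl dual_mulDr.

End DualNumbers.

(** * Derivations defined on a subring *)

Section Derivations.
Variable A : pzRingType.
Implicit Types (d : A -> A).

(* Unlike [derivation_on], the values need not lie in [S]. *)
Definition derivation_from (S : set A) d : Prop :=
  (forall a b, S a -> S b -> d (a + b) = d a + d b) /\
  (forall a b, S a -> S b -> d (a * b) = d a * b + a * d b).

Lemma derivation_from0 S d : subring S -> derivation_from S d -> d 0 = 0.
Proof.
move=> subS [dD _]; apply: (addrI (d 0)).
by rewrite -dD ?addr0 //; apply: subring0.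
Qed.

Lemma derivation_from1 S d : subring S -> derivation_from S d -> d 1 = 0.
Proof.
move=> subS [_ dM]; apply: (addrI (d 1)).
have S1 := subring1 subS.
by have := dM 1 1 S1 S1; rewrite !mulr1 mul1r addr0 => /esym.
Qed.

Lemma derivation_fromN S d a :
  subring S -> derivation_from S d -> S a -> d (- a) = - d a.
Proof.
move=> subS dS Sa; apply: (addrI (d a)).
rewrite subrr -dS.1 ?subrr ?(derivation_from0 subS dS) //.
exact: subringN.
Qed.

(** Reduces the vanishing of a derivation on [S] to its vanishing on generators. *)
Lemma derivation_from_kernel S d : subring S -> derivation_from S d ->
  subring [set a | S a /\ d a = 0].
Proof.
move=> subS dS; apply/subringP; split=> /=.
- by split; [exact: subring1 | exact: derivation_from1 dS].
- move=> a b [Sa da] [Sb db]; split; first exact: subringB.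
  by rewrite dS.1 ?(derivation_fromN subS dS) ?da ?db ?subr0//; apply: subringN.
- move=> a b [Sa da] [Sb db]; split; first exact: subringM.
  by rewrite dS.2 // da db mul0r mulr0 addr0.
Qed.

(** The mixed terms [d' a * d b] and [d a * d' b] cancel. [d] preserves [S] so that [d'] can be
    expanded at [d a], and is a derivation on all of [A] because [d'] may leave [S]. *)
Lemma derivation_from_bracket S d d' : subring S ->
  derivation_on S d -> derivation_from S d' -> derivation_from [set: A] d ->
  derivation_from S (fun a => d (d' a) - d' (d a)).
Proof.
move=> subS [dS _ _] [d'D d'M] [dD dM]; split=> a b Sa Sb.
  have [Sda Sdb] := (dS a Sa, dS b Sb).
  by rewrite d'D // !dD // d'D // opprD addrACA.
have [Sda Sdb] := (dS a Sa, dS b Sb).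
have Sdab : S (d a * b) by apply: subringM.
have Sadb : S (a * d b) by apply: subringM.
rewrite d'M // dM // dD // !dM // d'D // !d'M // mulrBl mulrBr.
set p := d (d' a) * b; set q := d' a * d b; set r := d a * d' b.
rewrite [r + _]addrC [p + q + _]addrACA [X in _ - X](_ : _ =
  (d' (d a) * b + a * d' (d b)) + (q + r));
  last by rewrite [q + _]addrC addrACA [r + q]addrC.
by rewrite opprD [LHS]addrACA subrr addr0 opprD addrACA.
Qed.

End Derivations.

(** * Extending derivations along a tower of Ore extensions *)

Section OreToDerivations.

(** The relation needed to send x to x + e eps reads, in the eps-part, e r + x delta(r) = delta(r) x
    + r e + delta(d r), which the two commutation hypotheses supply. *)
Lemma extend_derivation (A : pzRingType) (R : set A) x d S delta e :
  ore_extension R x d S -> derivation_from R delta ->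
  (forall r, R r -> e * r = r * e) ->
  (forall r, R r -> ad x (delta r) = delta (d r)) ->
  exists delta', [/\ derivation_from S delta',
    forall r, R r -> delta' r = delta r & delta' x = e].
Proof.
move=> oreS [deltaD deltaM] eC adC.
have [[subR subS RS Sx _] [comm univ]] := oreS.
pose f (r : A) : dual A := (r, delta r).
have [||[g [[g1 gD gM] gR gx]] _] := univ (dual A) f (x, e).
- split=> [|a b Ra Rb|a b Ra Rb].
  + by rewrite /f (derivation_from1 subR).
  + by rewrite /f deltaD.
  + by rewrite /f deltaM.
- move=> r Rr; congr pair; first exact: comm.
  by rewrite /= -adC // eC // /ad addrAC [_ + (_ - _)]addrC subrK addrC.
(* The first component of [g] is the identity on [R] and at [x], hence on [S]; multiplicativity of
   [g] then becomes the Leibniz rule in the second component. *)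
have g_fst : S `<=` [set a | S a /\ (g a).1 = a].
  apply: (ore_extension_generated oreS) => /=.
  - apply/subringP; split=> /=.
    + by split; [exact: subring1|rewrite g1].
    + move=> a b [Sa ga] [Sb gb]; split; first exact: subringB.
      by rewrite (ring_hom_onB subS (And3 g1 gD gM)) //= ga gb.
    + by move=> a b [Sa ga] [Sb gb]; split; [exact: subringM|rewrite gM //= ga gb].
  - by move=> r Rr; split; [exact: RS|rewrite gR].
  - by rewrite gx.
exists (fun a => (g a).2); split=> [|r Rr|]; last by rewrite gx.
- split=> a b Sa Sb; first by rewrite gD.
  by rewrite gM //= (g_fst a Sa).2 (g_fst b Sb).2.
- by rewrite gR.
Qed.

Variables (A : pzRingType) (s : nat) (B : set A) (x : 'I_s -> A).
Variable C : nat -> set A.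
Hypothesis C0 : C 0%N = B.
Hypothesis oreC :
  forall i : 'I_s, ore_extension (C i) (x i) (ad (x i)) (C i.+1).

Lemma iterated_ore_generated (S : set A) n : (n <= s)%N ->
  subring S -> B `<=` S -> (forall i : 'I_s, (i < n)%N -> S (x i)) ->
  C n `<=` S.
Proof.
move=> + subS BS; elim: n => [|n IH] ns xS; first by rewrite C0.
apply: (ore_extension_generated (oreC (Ordinal ns))) => //=; last exact: xS.
by apply: IH => [|i ?]; [exact: ltnW|apply: xS; apply: ltnW].
Qed.

Lemma iterated_ore_mono m n : (m <= n <= s)%N -> C m `<=` C n.
Proof.
elim: n => [|n IH] /andP[mn ns]; first by move: mn; rewrite leqn0 => /eqP->.
move: mn; rewrite leq_eqVlt => /predU1P[->//|mn].
apply: subset_trans (IH _) _; first by rewrite -ltnS mn (ltnW ns).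
by have [[_ _ + _ _] _] := oreC (Ordinal ns).
Qed.

Lemma iterated_ore_gen (i : 'I_s) n : (i < n <= s)%N -> C n (x i).
Proof. by move=> /iterated_ore_mono; apply; have [[]] := oreC i. Qed.

Hypothesis subC : forall i, (i <= s)%N -> subring (C i).
Hypothesis adB : forall i b, B b -> B (ad (x i) b).
Hypothesis adx : forall i j, B (ad (x i) (x j)).

(** The value prescribed at each new variable is 0 or 1, hence central, as [extend_derivation]
    requires. *)
Lemma partial_derivative (i : 'I_s) n : (n <= s)%N ->
  exists delta, [/\ derivation_from (C n) delta,
    forall b, B b -> delta b = 0
    & forall j : 'I_s, (j < n)%N -> delta (x j) = (i == j)%:R].
Proof.
elim: n => [|n IH] ns.
  exists (fun=> 0); split=> //; split=> a b _ _; first by rewrite addr0.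
  by rewrite mul0r mulr0 addr0.
have [delta [deltaP deltaB deltax]] := IH (ltnW ns).
pose k := Ordinal ns.
have oreCk : ore_extension (C n) (x k) (ad (x k)) (C n.+1) := oreC k.
have [[subCn _ _ _ adCn] _] := oreCk.
have BC : B `<=` C n.
  by rewrite -C0; apply: iterated_ore_mono; rewrite (ltnW ns).
(* The elements of [C n] on which [delta] commutes with [ad (x k)] form the kernel of a bracket of
   derivations, so generators suffice; on them both composites vanish. *)
have adC : C n `<=` [set a | C n a /\ ad (x k) (delta a) - delta (ad (x k) a) = 0].
  apply: iterated_ore_generated; first exact: ltnW.
  - apply: derivation_from_kernel => //; apply: derivation_from_bracket => //.
    by split=> a b _ _; [exact: ad_add|exact: ad_mul].
  - move=> b Bb /=; split; first exact: BC.
    by rewrite !deltaB ?subr0 /ad ?mulr0 ?mul0r ?subr0//; apply: adB.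
  - move=> j jn /=; split.
      by apply: iterated_ore_gen; rewrite jn (ltnW ns).
    rewrite deltax // deltaB; last exact: adx.
    by rewrite subr0 /ad mulr_natr mulr_natl subrr.
have [r _|r /adC[_ /subr0_eq]//|delta' [d'P d'R d'x]] :=
  extend_derivation (e := (i == k)%:R) oreCk deltaP.
  by rewrite mulr_natl mulr_natr.
exists delta'; split=> // [b Bb|j]; first by rewrite d'R ?deltaB //; apply: BC.
rewrite ltnS leq_eqVlt => /predU1P[jk|jn].
  by have -> : j = k by exact: val_inj.
rewrite d'R ?deltax //.
by apply: iterated_ore_gen; rewrite jn (ltnW ns).
Qed.

End OreToDerivations.

(** * Calculus of derivations of a whole ring *)

Section TotalDerivations.
Variables (A : pzRingType) (d : A -> A).
Hypothesis dP : derivation_from [set: A] d.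

Lemma subringT : subring [set: A].
Proof. by apply/subringP. Qed.

Lemma derivationD a b : d (a + b) = d a + d b.
Proof. exact: dP.1. Qed.

Lemma derivationM a b : d (a * b) = d a * b + a * d b.
Proof. exact: dP.2. Qed.

Lemma derivation0 : d 0 = 0.
Proof. exact: derivation_from0 subringT dP. Qed.

Lemma derivation1 : d 1 = 0.
Proof. exact: derivation_from1 subringT dP. Qed.

Lemma derivationN a : d (- a) = - d a.
Proof. by rewrite (derivation_fromN subringT dP). Qed.

Lemma derivationB a b : d (a - b) = d a - d b.
Proof. by rewrite derivationD derivationN. Qed.

Lemma derivation_nat n : d n%:R = 0.
Proof.
by elim: n => [|n IH]; rewrite ?derivation0 // mulrS derivationD derivation1 IH addr0.
Qed.

Lemma derivation_ad x a : d (ad x a) = ad (d x) a + ad x (d a).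
Proof.
by rewrite /ad derivationB !derivationM opprD [- _ + - _]addrC addrACA.
Qed.

Lemma iter_derivationD n a b : iter n d (a + b) = iter n d a + iter n d b.
Proof. by elim: n => //= n ->; rewrite derivationD. Qed.

Lemma iter_derivation0 n : iter n d 0 = 0.
Proof. by elim: n => //= n ->; rewrite derivation0. Qed.

Lemma iter_derivationN n a : iter n d (- a) = - iter n d a.
Proof. by elim: n => //= n ->; rewrite derivationN. Qed.

Lemma iter_derivationMl n c a :
  d c = 0 -> iter n d (c * a) = c * iter n d a.
Proof. by move=> dc; elim: n => //= n ->; rewrite derivationM dc mul0r add0r. Qed.

Lemma iter_derivationMr n c a :
  d c = 0 -> iter n d (a * c) = iter n d a * c.
Proof. by move=> dc; elim: n => //= n ->; rewrite derivationM dc mulr0 addr0. Qed.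

Lemma iter_derivation_le m n a :
  (m <= n)%N -> iter m d a = 0 -> iter n d a = 0.
Proof. by move=> /subnK <-; rewrite iterD => ->; rewrite iter_derivation0. Qed.

(** Induction on m + n replaces the binomial expansion: one application of [d] splits [a * b] into
    [d a * b] and [a * d b], each with one exponent lowered. *)
Lemma iter_derivationM0 m n a b :
  iter m d a = 0 -> iter n d b = 0 -> iter (m + n) d (a * b) = 0.
Proof.
have [k] := ubnP (m + n)%N; elim: k m n a b => // k IH [|m] n a b.
  by move=> _ a0 _; rewrite (a0 : a = 0) mul0r iter_derivation0.
case: n => [|n].
  by move=> _ _ b0; rewrite (b0 : b = 0) mulr0 iter_derivation0.
rewrite addSn ltnS => mnk da db.
rewrite iterSr derivationM iter_derivationD IH ?add0r -?iterSr // -addSnnS.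
by rewrite IH -?iterSr // addSnnS.
Qed.

(** Lets local nilpotency be checked on generators. *)
Lemma subring_nilpotent : subring [set a | exists n, iter n d a = 0].
Proof.
apply/subringP; split=> /=.
- by exists 1%N; rewrite /= derivation1.
- move=> a b [m da] [n db]; exists (maxn m n).
  rewrite iter_derivationD iter_derivationN.
  rewrite (iter_derivation_le _ da) ?leq_maxl // (iter_derivation_le _ db) ?leq_maxr //.
  by rewrite subrr.
- by move=> a b [m da] [n db]; exists (m + n)%N; exact: iter_derivationM0.
Qed.

Lemma derivationX x n : d x = 1 -> d (x ^+ n) = n%:R * x ^+ n.-1.
Proof.
move=> dx; case: n => [|n]; first by rewrite derivation1 mul0r.
elim: n => [|n IH]; first by rewrite dx mulr1.
rewrite exprS derivationM dx IH mul1r /= mulr_natl.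
by rewrite mulrnAr -exprS mulr_natl [RHS]mulrS.
Qed.

(** The falling factorial vanishes for k > n, so the truncated exponent is harmless. *)
Lemma iter_derivationX x n k :
  d x = 1 -> iter k d (x ^+ n) = (n ^_ k)%:R * x ^+ (n - k).
Proof.
move=> dx; elim: k => [|k IH]; first by rewrite mul1r subn0.
rewrite /= IH derivationM derivation_nat mul0r add0r derivationX //.
by rewrite mulrA -natrM -ffactnSr subnS.
Qed.

End TotalDerivations.

(** * From an iterated Ore extension to locally nilpotent derivations *)

Section OreToLnd.
Variables (K : fieldType) (A : algebra K) (s : nat).

Lemma K_derivation_from (d : A -> A) :
  K_derivation d -> derivation_from [set: A] d.
Proof. by case=> -[]. Qed.

Lemma iterated_ore_lnd (B : set A) (x : 'I_s -> A) :
  iterated_ore_extension B x -> (forall i b, B b -> B (ad (x i) b)) ->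
  (forall i j, B (ad (x i) (x j))) ->
  exists delta, commuting_lnd_with_dual_elements delta x.
Proof.
move=> [C [C0 Cs subC oreC]] adB adx.
have subC' i : (i <= s)%N -> subring (C i) by case/subC.
have gen (S : set A) : subring S -> B `<=` S -> (forall i, S (x i)) -> S = [set: A].
  move=> subS BS xS; apply/seteqP; split=> //; rewrite -Cs.
  exact: (iterated_ore_generated C0 oreC).
have /choice[delta deltaP] i := partial_derivative C0 oreC adB adx i (leqnn s).
rewrite Cs in deltaP.
have deltaD i : derivation_from [set: A] (delta i) by case: (deltaP i).
have deltaB i b : B b -> delta i b = 0 by have [_ + _] := deltaP i; apply.
have deltax i j : delta i (x j) = (i == j)%:R by have [_ _] := deltaP i; apply.
exists delta; split=> //.
- move=> i; split.
    by split=> // a b; [case: (deltaD i) => + _ | case: (deltaD i) => _]; apply.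
  (* K-linearity is the Leibniz rule: the image of k lies in the subalgebra [B], on which [delta i]
     vanishes. *)
  move=> k a; rewrite (derivationM (deltaD i)) deltaB ?mul0r ?add0r //.
  have [subB BK] := subC 0%N isT.
  by rewrite -[alg_map A k]mulr1 -C0; apply: BK; apply: subring1.
- move=> i a.
  have nilT : [set b | exists n, iter n (delta i) b = 0] = [set: A].
    apply: gen; first exact: subring_nilpotent.
    + by move=> b Bb; exists 1%N; rewrite /= deltaB.
    + by move=> j; exists 2%N; rewrite /= deltax (derivation_nat (deltaD i)).
  by have : [set: A] a by []; rewrite -nilT.
- move=> i j a; apply: subr0_eq.
  (* The bracket of two of these derivations is a derivation that vanishes on [B] and at every
     variable. *)
  have D : derivation_from [set: A] (fun a => delta i (delta j a) - delta j (delta i a)).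
    apply: derivation_from_bracket => //; first exact: subringT.
    by split=> // b c; [case: (deltaD i) => + _ | case: (deltaD i) => _]; apply.
  have kerT : [set b | [set: A] b /\
      delta i (delta j b) - delta j (delta i b) = 0] = [set: A].
    apply: gen; first exact: derivation_from_kernel (subringT A) D.
    + move=> b Bb; split=> //; rewrite (deltaB j) // [delta i b]deltaB //.
      by rewrite !(derivation0 (deltaD _)) subr0.
    + by split=> //; rewrite !deltax !(derivation_nat (deltaD _)) subr0.
  by have : [set: A] a by []; rewrite -kerT => -[].
Qed.

End OreToLnd.

(* The graph of the homomorphism \sum_k r_k x^k |-> \sum_k f(r_k) t^k, built up
   by Horner's scheme. *)
Inductive horner_graph (A T : pzRingType) (R : set A) (f : A -> T) (x : A)
    (t : T) : A -> T -> Prop :=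
  | HornerConst r : R r -> horner_graph R f x t r (f r)
  | HornerStep r a u : R r -> horner_graph R f x t a u ->
      horner_graph R f x t (r + a * x) (f r + u * t).

(** * Homomorphisms out of an Ore extension by Horner's scheme *)

Section HornerGraph.
Variables (A T : pzRingType) (R : set A) (f : A -> T) (x : A) (t : T).
Variables (d : A -> A).
Hypotheses (subR : subring R) (fH : ring_hom_on R f).
Hypothesis dR : forall r, R r -> R (d r).
Hypothesis xC : forall r, R r -> x * r = r * x + d r.
Hypothesis tC : forall r, R r -> t * f r = f r * t + f (d r).
Local Notation G := (horner_graph R f x t).

Lemma horner_graphD a b u v : G a u -> G b v -> G (a + b) (u + v).
Proof.
have [_ fD _] := fH.
move=> Ga; elim: Ga b v => {a u} [r Rr|r a u Rr Ga IH] b v [r' Rr'|r' b' v' Rr' Gb].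
- by rewrite -fD //; apply: HornerConst; apply: subringD.
- by rewrite !addrA -fD //; apply: HornerStep => //; apply: subringD.
- by rewrite addrAC [X in G _ X]addrAC -fD //; apply: HornerStep => //; apply: subringD.
- rewrite addrACA -mulrDl [X in G _ X]addrACA -mulrDl -fD //.
  by apply: HornerStep; [exact: subringD|exact: IH].
Qed.

Lemma horner_graphMl r a u : R r -> G a u -> G (r * a) (f r * u).
Proof.
have [_ _ fM] := fH.
move=> Rr; elim=> {a u} [r' Rr'|r' a u Rr' _ IH].
  by rewrite -fM //; apply: HornerConst; apply: subringM.
by rewrite !mulrDr !mulrA -fM //; apply: HornerStep => //; apply: subringM.
Qed.

Lemma horner_graphMx a u : G a u -> G (a * x) (u * t).
Proof.
have R0 := subring0 subR.
by move=> /(HornerStep R0); rewrite (ring_hom_on0 subR fH) !add0r.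
Qed.

(** The relations for x and t enter here: they turn x r into the Horner expression d(r) + r x, and t
    f(r) likewise. *)
Lemma horner_graphxM a u : G a u -> G (x * a) (t * u).
Proof.
elim=> {a u} [r Rr|r a u Rr _ IH].
  rewrite xC // tC // addrC [X in G _ X]addrC.
  by apply: HornerStep; [exact: dR|exact: HornerConst].
rewrite !mulrDr !mulrA; apply: horner_graphD; last exact: horner_graphMx.
rewrite xC // tC // addrC [X in G _ X]addrC.
by apply: HornerStep; [exact: dR|exact: HornerConst].
Qed.

(** Since (r + a x) b = r b + a (x b), the induction on the left factor keeps the right factor
    general. *)
Lemma horner_graphM a b u v : G a u -> G b v -> G (a * b) (u * v).
Proof.
move=> Ga; elim: Ga b v => {a u} [r Rr|r a u Rr _ IH] b v Gb.
  exact: horner_graphMl.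
rewrite !mulrDl -!mulrA; apply: horner_graphD; first exact: horner_graphMl.
exact/IH/horner_graphxM.
Qed.

(** By additivity it suffices that 0 is related only to 0: if r + a x = 0, freeness gives a = 0,
    then r = 0, and the induction descends to a. *)
Lemma horner_graph_functional :
  (forall r a, R r -> r + a * x = 0 -> a = 0) ->
  forall a u u', G a u -> G a u' -> u = u'.
Proof.
move=> free a u u' Gu Gu'; have R1 := subring1 subR.
have fN1 : f (- 1) = - 1.
  rewrite -sub0r (ring_hom_onB subR fH) ?(ring_hom_on0 subR fH) //.
    by case: fH => -> _ _; rewrite !sub0r.
  exact: subring0.
have G0 b v : G b v -> b = 0 -> v = 0.
  elim=> {b v} [r _ ->|r b v Rr _ IH rb]; first exact: ring_hom_on0 fH.
  have b0 := free _ _ Rr rb; move: rb; rewrite b0 mul0r addr0 => ->.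
  by rewrite IH // mul0r addr0 (ring_hom_on0 subR fH).
apply: subr0_eq; apply: (G0 (a - a)); last exact: subrr.
rewrite -[- a]mulN1r -[- u']mulN1r -fN1; apply: horner_graphD => //.
by apply: horner_graphMl => //; apply: subringN.
Qed.

End HornerGraph.

(** * One locally nilpotent derivation with [delta x = 1] *)

Section Characteristic0.
Variables (K : fieldType) (A : algebra K).
Hypothesis charK0 : [pchar K] =i pred0.

(** Characteristic zero enters here: positive integers are invertible in [K]. *)
Lemma alg_map_natVK n (a : A) :
  (0 < n)%N -> alg_map A n%:R^-1 * (n%:R * a) = a.
Proof.
move=> n0; rewrite mulrA -(rmorph_nat (alg_map A)) -rmorphM mulVf.
  by rewrite rmorph1 mul1r.
by rewrite ((pcharf0P _).1 charK0) // -lt0n.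
Qed.

Lemma natr_mul_eq0 n (a : A) : (0 < n)%N -> n%:R * a = 0 -> a = 0.
Proof. by move=> n0 na; rewrite -(alg_map_natVK a n0) na mulr0. Qed.

Variables (S : set A) (delta : A -> A) (x : A).
Hypotheses (subS : subalgebra S) (KD : K_derivation delta).
Hypothesis lnd : locally_nilpotent delta.
Hypothesis deltaS : forall a, S a -> S (delta a).
Hypotheses (Sx : S x) (deltax : delta x = 1).

Let deltaP : derivation_from [set: A] delta := K_derivation_from KD.
Let R := [set a | S a /\ delta a = 0].

(** Only two terms of the Leibniz expansion survive, since [delta x = 1]. *)
Let iter_mulx n a : iter n.+1 delta (a * x) =
  iter n.+1 delta a * x + n.+1%:R * iter n delta a.
Proof.
elim: n => [|n IH]; first by rewrite /= (derivationM deltaP) // deltax mulr1 mul1r.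
rewrite iterS IH (derivationD deltaP) !(derivationM deltaP).
rewrite (derivation_nat deltaP) deltax.
by rewrite mulr1 mul0r add0r -addrA [n.+2%:R]mulrS mulrDl mul1r.
Qed.

(** If delta^(n+1) a = 0, applying delta^(n+1) to the relation leaves (n+1) delta^n a = 0; so the
    nilpotency order of a descends to 0. *)
Lemma lnd_free r a : R r -> r + a * x = 0 -> a = 0.
Proof.
move=> [_ dr] ra; have [n] := lnd a; elim: n => // n IH dna.
apply: IH; apply: (@natr_mul_eq0 n.+1) => //.
have := congr1 (iter n.+1 delta) ra.
rewrite (iter_derivationD deltaP) // iter_mulx dna iterSr dr !(iter_derivation0 deltaP) //.
by rewrite mul0r !add0r.
Qed.

(** This induction principle expresses that [S] is generated by [R] and [x]. It is proved by
    induction on the nilpotency order of a. *)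
Lemma lnd_ind (P : A -> Prop) :
  (forall r, R r -> P r) ->
  (forall a b, S a -> S b -> P a -> P b -> P (a + b)) ->
  (forall a, S a -> P a -> P (a * x)) ->
  forall a, S a -> P a.
Proof.
have [subrS SK] := subS.
move=> PR PD Px a Sa; have [n] := lnd a.
elim: n a Sa => [|n IH] a Sa dna.
  apply: PR; rewrite (dna : a = 0); split; first exact: subring0.
  exact: (derivation0 deltaP).
have Siter m : S (iter m delta a) by elim: m => //= m; apply: deltaS.
(* The leading coefficient: delta^n (c x^n) = n! c = delta^n a, so subtracting c x^n lowers the
   nilpotency order. *)
pose c := alg_map A n`!%:R^-1 * iter n delta a.
have Rc : R c by split; [exact: SK|rewrite KD.2 -iterS dna mulr0].
have [Pcx Scx] : P (c * x ^+ n) /\ S (c * x ^+ n).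
  elim: (n) => [|m [Pm Sm]]; first by rewrite mulr1; split; [exact: PR|case: Rc].
  by rewrite exprSr mulrA; split; [exact: Px|exact: subringM].
rewrite -[a](subrK (c * x ^+ n)); apply: PD => //; first exact: subringB.
apply: IH; first exact: subringB.
rewrite (iter_derivationD deltaP) (iter_derivationN deltaP).
rewrite (iter_derivationMl deltaP); last by case: Rc.
rewrite (iter_derivationX deltaP) // ffactnn subnn mulr1 /c -mulrA.
rewrite [_ * n`!%:R]mulr_natr -(mulr_natl (iter n delta a)).
by rewrite alg_map_natVK ?subrr ?fact_gt0.
Qed.

(** The Horner graph is total on [S] by [lnd_ind] and single-valued by [lnd_free], which gives
    existence; uniqueness is [lnd_ind] again. *)
Lemma ore_extension_lnd : ore_extension R x (ad x) S.
Proof.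
have [subrS SK] := subS.
have subR : subring R.
  apply: derivation_from_kernel => //.
  by split=> a b _ _; [exact: derivationD|exact: derivationM].
(* [ad x] preserves the kernel because [delta x = 1] is central. *)
have adR r : R r -> R (ad x r).
  move=> [Sr dr]; split; last first.
    by rewrite (derivation_ad deltaP) // deltax dr /ad mul1r mulr1 mulr0 mul0r !subrr addr0.
  by apply: subringB => //; apply: subringM.
have comm r : x * r = r * x + ad x r by rewrite /ad addrC subrK.
split; [split=> // [r []//|]|split=> // [T f t fH tC]].
  by split=> // a b _ _; [exact: ad_add|exact: ad_mul].
pose G := horner_graph R f x t.
have Gtotal a : S a -> exists u, G a u.
  move: a; apply: lnd_ind.
  - by move=> r Rr; exists (f r); apply: HornerConst.
  - by move=> a b _ _ [u Gu] [v Gv]; exists (u + v); apply: horner_graphD.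
  - by move=> a _ [u Gu]; exists (u * t); apply: horner_graphMx.
have Gfun a u u' : G a u -> G a u' -> u = u'.
  by apply: (horner_graph_functional subR fH); exact: lnd_free.
split.
  (* The default 0 is never taken on [S], where the graph is total. *)
  pose g a := xget 0 [set u | G a u].
  have Gg a : S a -> G a (g a) by move=> /Gtotal[u Gu]; exact: (xgetPex 0 (ex_intro _ u Gu)).
  have gE a u : S a -> G a u -> g a = u by move=> Sa; apply: Gfun; exact: Gg.
  have [f1 fD fM] := fH; have R1 := subring1 subR.
  have G1 : G 1 1 by rewrite -f1; apply: HornerConst.
  exists g; split; first split.
  - by apply: gE G1; apply: subring1.
  - move=> a b Sa Sb; apply: gE; first exact: subringD.
    by apply: horner_graphD => //; exact: Gg.
  - move=> a b Sa Sb; apply: gE; first exact: subringM.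
    by apply: (horner_graphM subR fH adR) => //; exact: Gg.
  - by move=> r Rr; apply: gE; [case: Rr|exact: HornerConst].
  - by apply: gE => //; rewrite -[x]mul1r -[t]mul1r; apply: horner_graphMx.
move=> g h [g1 gD gM] gR gx [h1 hD hM] hR hx.
apply: lnd_ind.
- by move=> r Rr; rewrite gR ?hR.
- by move=> a b Sa Sb ga gb; rewrite gD // hD // ga gb.
- by move=> a Sa ga; rewrite gM // hM // ga gx hx.
Qed.

End Characteristic0.

(** * Internal direct sums *)

Section DirectSum.
Variables (V : zmodType) (I : choiceType).

Lemma sum_finsupp (c : {fsfun I -> V with 0}) (r : seq I) : uniq r ->
  (forall i, i \in finsupp c -> i \in r) ->
  \sum_(i <- finsupp c) c i = \sum_(i <- r) c i.
Proof.
move=> ur cr; rewrite [RHS](bigID (fun i => i \in finsupp c)) /=.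
rewrite [X in _ + X]big1 ?addr0; last by move=> i; exact: fsfun_dflt.
rewrite -[RHS]big_filter; apply: perm_big; apply: uniq_perm.
- exact: fset_uniq.
- exact: filter_uniq.
- by move=> i; rewrite mem_filter; case: (boolP (i \in finsupp c)) => // /cr ->.
Qed.

(** Trades finitely supported functions for duplicate-free lists with a coefficient function, the
    form in which spanning and independence are proved below. *)
Lemma direct_sum_criterion (D : set I) (U : I -> set V) (W : set V) :
  (forall i, U i 0) ->
  (forall i a b, U i a -> U i b -> U i (a - b)) ->
  W 0 -> (forall a b, W a -> W b -> W (a + b)) ->
  (forall i, D i -> U i `<=` W) ->
  (forall w, W w -> exists (r : seq I) c,
    [/\ uniq r, forall i, i \in r -> D i /\ U i (c i) & w = \sum_(i <- r) c i]) ->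
  (forall (r : seq I) c, uniq r -> (forall i, i \in r -> D i /\ U i (c i)) ->
    \sum_(i <- r) c i = 0 -> forall i, i \in r -> c i = 0) ->
  direct_sum D U W.
Proof.
move=> U0 UB W0 WD UW span free; split; last first.
  move=> w c [DU ->]; rewrite big_seq; elim/big_ind: _ => // i /DU[Di Ui].
  exact: UW Ui.
move=> w /span[r [c [ur DU ->]]].
have r_fset i : (i \in [fset j in r]%fset) = (i \in r) by rewrite !inE.
pose C : {fsfun I -> V with 0} := [fsfun i in [fset j in r]%fset => c i].
have CE i : i \in r -> C i = c i by rewrite /C fsfunE r_fset => ->.
have Csub i : i \in finsupp C -> i \in r.
  by rewrite mem_finsupp /C fsfunE r_fset; case: ifP; rewrite ?eqxx.
have sumC : \sum_(i <- r) c i = \sum_(i <- finsupp C) C i.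
  by rewrite (sum_finsupp ur) //; apply: eq_big_seq => i /CE.
exists C; split.
  by split=> // i /Csub ir; rewrite CE //; apply: DU.
move=> C' [DU' sumC']; apply/fsfunP => i.
(* Both decompositions are compared over the union of their supports, where their difference is a
   relation. *)
pose r' := (finsupp C `|` finsupp C')%fset.
have r'P j : j \in r' -> D j /\ U j (C j - C' j).
  rewrite in_fsetU => jr'; split.
    by case/orP: jr' => [/Csub/DU[]|/DU'[]].
  apply: UB.
    by case: (finsuppP C j) => [_|/Csub jr]; [exact: U0|rewrite CE //; case: (DU j jr)].
  by case: (finsuppP C' j) => [_|/DU'[]//]; exact: U0.
have [ir'|] := boolP (i \in r').
  apply: subr0_eq; apply: (free _ (fun j => C j - C' j) (fset_uniq r') r'P _ i ir').
  rewrite big_split sumrN -!sum_finsupp ?fset_uniq ?subr_eq0 //=.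
  - by rewrite -sumC -sumC' subrr.
  - by move=> j jC; rewrite in_fsetU jC ?orbT.
  - by move=> j jC; rewrite in_fsetU jC ?orbT.
by rewrite in_fsetU negb_or => /andP[iC iC']; rewrite !fsfun_dflt.
Qed.

End DirectSum.

(** * Multi-indices of a given total degree *)

Section Multidegrees.
Variable s : nat.
Implicit Types a b : {ffun 'I_s -> nat}.

(** Entries of a multi-index of degree n are at most n, so a finite enumeration of functions into
    ['I_n.+1] finds them all. *)
Definition multidegrees (n : nat) : seq {ffun 'I_s -> nat} :=
  [seq a <- [seq [ffun i => nat_of_ord (f i)] | f : {ffun 'I_s -> 'I_n.+1}]
    | mdeg a == n].

Lemma multidegrees_uniq n : uniq (multidegrees n).
Proof.
apply: filter_uniq; rewrite map_inj_uniq ?enum_uniq // => f g /ffunP fg.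
by apply/ffunP => i; apply: val_inj; have := fg i; rewrite !ffunE.
Qed.

Lemma mem_multidegrees n a : (a \in multidegrees n) = (mdeg a == n).
Proof.
rewrite mem_filter; case: eqP => //= an; apply/mapP.
have ai i : (a i < n.+1)%N by rewrite ltnS -an /mdeg (bigD1 i) //= leq_addr.
exists [ffun i => Ordinal (ai i)]; first by rewrite mem_enum.
by apply/ffunP => i; rewrite !ffunE.
Qed.

(** A strict inequality at one index would force [mdeg b < mdeg a]. *)
Lemma mdeg_eq a b : (mdeg a <= mdeg b)%N -> (forall i, b i <= a i)%N -> b = a.
Proof.
move=> ab ba; apply/ffunP => i; apply/eqP; rewrite eqn_leq ba /=.
move: ab; rewrite /mdeg (bigD1 i) //= [X in (_ <= X)%N](bigD1 i) //=.
rewrite leqNgt; apply: contraNT; rewrite -ltnNge -addSn => bai.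
by apply: leq_add => //; apply: leq_sum.
Qed.

End Multidegrees.

(** * Several commuting derivations with dual elements *)

Section DualElements.
Variables (K : fieldType) (A : algebra K) (s : nat).
Hypothesis charK0 : [pchar K] =i pred0.
Variables (delta : 'I_s -> A -> A) (x : 'I_s -> A).
Hypothesis dualP : commuting_lnd_with_dual_elements delta x.

Let KD i : K_derivation (delta i). Proof. by case: dualP. Qed.
Let deltaP i : derivation_from [set: A] (delta i).
Proof. exact: K_derivation_from. Qed.
Let lnd i : locally_nilpotent (delta i). Proof. by case: dualP. Qed.
Let deltaC i j a : delta i (delta j a) = delta j (delta i a).
Proof. by case: dualP. Qed.
Let deltax i j : delta i (x j) = (i == j)%:R. Proof. by case: dualP. Qed.

Lemma invariantsP a : invariants delta a <-> forall i, delta i a = 0.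
Proof. by split=> [h i|h i _]; apply: h. Qed.

(** The intermediate algebras of the tower, from the invariants at n = 0 to all of [A] at n = s. *)
Let kerge n : set A := [set a | forall i : 'I_s, (n <= i)%N -> delta i a = 0].

Let subalgebra_kerge n : subalgebra (kerge n).
Proof.
split; last by move=> k b kb i ni; rewrite (KD i).2 kb ?mulr0.
apply/subringP; split=> [i _|a b ka kb i ni|a b ka kb i ni].
- exact: (derivation1 (deltaP _)).
- by rewrite (derivationB (deltaP _)) // ka ?kb ?subrr.
- by rewrite (derivationM (deltaP _)) // ka ?kb // mul0r mulr0 addr0.
Qed.

Let kerge0 : kerge 0 = invariants delta.
Proof.
by apply/seteqP; split=> a; [move=> k; apply/invariantsP => i; apply: k
                            |move/invariantsP => k i _].
Qed.

Lemma subalgebra_invariants : subalgebra (invariants delta).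
Proof. by rewrite -kerge0. Qed.

(** Each step is the case of one derivation, [delta i] on [kerge i.+1]. Commutation makes [delta i]
    preserve this algebra, and duality puts [x i] in it. *)
Lemma iterated_ore_extension_invariants :
  iterated_ore_extension (invariants delta) x.
Proof.
exists kerge; split=> //.
  by apply/seteqP; split=> // a _ i; rewrite leqNgt ltn_ord.
move=> i; have -> : kerge i = [set a | kerge i.+1 a /\ delta i a = 0].
  apply/seteqP; split=> a /=.
    by move=> ka; split=> [j ij|]; apply: ka => //; apply: ltnW.
  move=> [ka da] j; rewrite leq_eqVlt => /predU1P[/val_inj <- //|]; exact: ka.
apply: (ore_extension_lnd charK0) => //.
- by move=> a ka j ij; rewrite deltaC ka ?(derivation0 (deltaP _)).
- by move=> j ij; rewrite deltax; case: eqP ij => // ->; rewrite ltnn.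
- by rewrite deltax eqxx.
Qed.

Lemma invariants_ad i b : invariants delta b -> invariants delta (ad (x i) b).
Proof.
move=> /invariantsP db; apply/invariantsP => j.
rewrite (derivation_ad (deltaP _)) deltax db /ad mulr_natl mulr_natr.
by rewrite mulr0 mul0r !subrr addr0.
Qed.

Lemma invariants_adx i j : invariants delta (ad (x i) (x j)).
Proof.
apply/invariantsP => k.
by rewrite (derivation_ad (deltaP _)) // !deltax /ad !mulr_natl !mulr_natr !subrr addr0.
Qed.

(** The x j need not commute, but [delta i] kills every factor except the power of [x i], and the
    resulting integer moves to the front. *)
Lemma iter_delta_prod (r : seq 'I_s) (e : 'I_s -> nat) i n :
  uniq r -> i \in r ->
  iter n (delta i) (\prod_(j <- r) x j ^+ e j) =
  (e i ^_ n)%:R * \prod_(j <- r) x j ^+ (e j - (i == j) * n).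
Proof.
have deltaX0 j k : i != j -> delta i (x j ^+ k) = 0.
  move=> ij; elim: k => [|k IH]; first exact: derivation1.
  by rewrite exprS (derivationM (deltaP _)) IH deltax (negPf ij) mul0r mulr0 addr0.
elim: r => // j r IH /= /andP[jr ur]; rewrite !big_cons in_cons.
case: (eqVneq i j) jr => [<- ir _|ij jr /= ir].
  have d0 : delta i (\prod_(k <- r) x k ^+ e k) = 0.
    elim: r ir {IH ur} => [_|k r IH]; first by rewrite big_nil (derivation1 (deltaP _)).
    rewrite in_cons negb_or big_cons => /andP[ik ir].
    by rewrite (derivationM (deltaP _)) deltaX0 // IH // mul0r mulr0 addr0.
  rewrite (iter_derivationMr (deltaP _)) // (iter_derivationX (deltaP _)).
    rewrite mul1n -mulrA; congr (_ * (_ * _)).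
    apply: eq_big_seq => k kr; case: eqP ir => [->|_ _]; first by rewrite kr.
    by rewrite subn0.
  by rewrite deltax eqxx.
rewrite subn0 (iter_derivationMl (deltaP _)) ?IH ?deltaX0 //.
by rewrite !mulrA (commr_nat (x j ^+ e j)).
Qed.

(** Generalises [delta_pow] to any list of indices, to allow induction on the list. *)
Definition seq_delta_pow (r : seq 'I_s) (b : 'I_s -> nat) : A -> A :=
  \big[comp/idfun]_(i <- r) iter (b i) (delta i).

Lemma seq_delta_pow_cons i r b a :
  seq_delta_pow (i :: r) b a = iter (b i) (delta i) (seq_delta_pow r b a).
Proof. by rewrite /seq_delta_pow big_cons. Qed.

Lemma seq_delta_powD r b a c :
  seq_delta_pow r b (a + c) = seq_delta_pow r b a + seq_delta_pow r b c.
Proof.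
elim: r => [|i r IH]; first by rewrite /seq_delta_pow big_nil.
by rewrite !seq_delta_pow_cons IH (iter_derivationD (deltaP _)).
Qed.

Lemma seq_delta_pow0 r b : seq_delta_pow r b 0 = 0.
Proof. by apply: (addrI (seq_delta_pow r b 0)); rewrite -seq_delta_powD !addr0. Qed.

Lemma seq_delta_powMl r b c a : invariants delta c ->
  seq_delta_pow r b (c * a) = c * seq_delta_pow r b a.
Proof.
move=> /invariantsP dc; elim: r => [|i r IH]; first by rewrite /seq_delta_pow big_nil.
by rewrite !seq_delta_pow_cons IH (iter_derivationMl (deltaP _)).
Qed.

Lemma seq_delta_powMr r b c a : invariants delta c ->
  seq_delta_pow r b (a * c) = seq_delta_pow r b a * c.
Proof.
move=> /invariantsP dc; elim: r => [|i r IH]; first by rewrite /seq_delta_pow big_nil.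
by rewrite !seq_delta_pow_cons IH (iter_derivationMr (deltaP _)).
Qed.

Lemma iter_deltaC i j n a : delta i (iter n (delta j) a) = iter n (delta j) (delta i a).
Proof. by elim: n => //= n <-. Qed.

Lemma seq_delta_powC i r b a :
  delta i (seq_delta_pow r b a) = seq_delta_pow r b (delta i a).
Proof.
elim: r => [|j r IH]; first by rewrite /seq_delta_pow big_nil.
by rewrite !seq_delta_pow_cons iter_deltaC IH.
Qed.

Lemma seq_delta_powS i r b a : uniq r -> i \in r ->
  delta i (seq_delta_pow r b a) = seq_delta_pow r (fun j => (i == j) + b j)%N a.
Proof.
elim: r => // j r IH /= /andP[jr ur]; rewrite in_cons !seq_delta_pow_cons.
case: (eqVneq i j) jr => [<- ir _|ij jr /= ir]; last by rewrite iter_deltaC IH.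
rewrite add1n /=; congr (delta i (iter _ _ (_ a))).
apply: eq_big_seq => k kr; case: eqP ir => [->|//]; by rewrite kr.
Qed.

(** By commutation the power of [delta i] can be applied to a first. *)
Lemma seq_delta_pow_eq0 i r (b : 'I_s -> nat) a : i \in r ->
  iter (b i) (delta i) a = 0 -> seq_delta_pow r b a = 0.
Proof.
move=> + da; elim: r => // j r IH; rewrite in_cons seq_delta_pow_cons.
case: (eqVneq i j) => [<- _|_ /= ir]; last by rewrite IH // (iter_derivation0 (deltaP _)).
have -> n : iter n (delta i) (seq_delta_pow r b a) = seq_delta_pow r b (iter n (delta i) a).
  by elim: n => //= n ->; rewrite seq_delta_powC.
by rewrite da seq_delta_pow0.
Qed.

Lemma seq_delta_pow_prod r (b e : 'I_s -> nat) : uniq r ->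
  seq_delta_pow r b (\prod_(j < s) x j ^+ e j) =
  (\prod_(i <- r) e i ^_ b i)%:R * \prod_(j < s) x j ^+ (e j - (j \in r) * b j).
Proof.
elim: r => [_|i r IH /= /andP[ir ur]].
  rewrite /seq_delta_pow !big_nil mul1r.
  by apply: eq_bigr => j _; rewrite subn0.
rewrite seq_delta_pow_cons IH // (iter_derivationMl (deltaP _)); last exact: derivation_nat.
rewrite iter_delta_prod ?index_enum_uniq ?mem_index_enum //.
rewrite (negPf ir) subn0 mulrA -natrM big_cons mulnC; congr (_ * _).
apply: eq_bigr => j _; rewrite in_cons [j == i]eq_sym.
case: (eqVneq i j) ir => [<-|_ _] /=; last by rewrite mul0n subn0.
by move=> /negPf->; rewrite subn0.
Qed.

Lemma delta_powE b : delta_pow delta b = seq_delta_pow (index_enum 'I_s) b.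
Proof. by []. Qed.

(** The coefficient is a product of falling factorials, nonzero only if b <= a entrywise; the degree
    hypothesis then forces b = a. *)
Lemma delta_pow_monomial (a b : {ffun 'I_s -> nat}) : (mdeg a <= mdeg b)%N ->
  delta_pow delta b (monomial x a) =
  if b == a then (\prod_(i < s) (a i)`!)%:R else 0.
Proof.
move=> ab; rewrite delta_powE seq_delta_pow_prod ?index_enum_uniq //.
case: eqP => [->|ba].
  rewrite [X in _ * X]big1 => [|i _]; last by rewrite mem_index_enum mul1n subnn.
  by rewrite mulr1; congr _%:R; apply: eq_bigr => i _; rewrite ffactnn.
have [/forallP ble|] := boolP [forall i, b i <= a i]%N.
  by case: ba; apply: mdeg_eq.
rewrite negb_forall => /existsP[i]; rewrite -ltnNge => abi.
by rewrite (bigD1 i) //= ffact_small // mul0r.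
Qed.

(** If delta_i^(n_i) a = 0 for all i, then |b| > n_1 + ... + n_s forces b_i >= n_i for some i. *)
Lemma bigcup_N : \bigcup_i N_ delta i = [set: A].
Proof.
apply/seteqP; split=> // a _.
have /choice[n dn] i := lnd i a.
exists (\sum_i n i)%N => // b nb; rewrite delta_powE.
have [/existsP[i ni]|] := boolP [exists i, n i <= b i]%N.
  apply: (seq_delta_pow_eq0 (i := i)); first exact: mem_index_enum.
  exact: iter_derivation_le (dn i).
rewrite negb_exists => /forallP bn; move: nb; rewrite ltnNge => /negP[].
by apply: leq_sum => i _; apply: ltnW; rewrite ltnNge.
Qed.

(* [phi a b] stands for either x^a b or b x^a. *)
Section Decomposition.
Variable phi : {ffun 'I_s -> nat} -> A -> A.
Hypothesis phiB : forall a b c, phi a (b - c) = phi a b - phi a c.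
Hypothesis phi_delta : forall a b c, invariants delta c ->
  (mdeg a <= mdeg b)%N -> delta_pow delta b (phi a c) =
  if b == a then (\prod_(i < s) (a i)`!)%:R * c else 0.

Let fact_gt0 (a : {ffun 'I_s -> nat}) : (0 < \prod_(i < s) (a i)`!)%N.
Proof. by rewrite prodn_gt0 // => i; apply: fact_gt0. Qed.

Let phi0 a : phi a 0 = 0.
Proof. by have := phiB a 0 0; rewrite !subrr. Qed.

Lemma delta_pow_sum b (r : seq {ffun 'I_s -> nat}) c :
  delta_pow delta b (\sum_(a <- r) c a) = \sum_(a <- r) delta_pow delta b (c a).
Proof.
by apply: (big_morph (delta_pow delta b)); [exact: seq_delta_powD|exact: seq_delta_pow0].
Qed.

Lemma delta_powS i (b : {ffun 'I_s -> nat}) a : delta i (delta_pow delta b a) =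
  delta_pow delta [ffun j => (i == j) + b j]%N a.
Proof.
rewrite !delta_powE seq_delta_powS ?index_enum_uniq ?mem_index_enum //.
by congr (seq_delta_pow _ _ a); apply/funext => j; rewrite ffunE.
Qed.

Lemma mdegS i (b : {ffun 'I_s -> nat}) :
  mdeg [ffun j => (i == j) + b j]%N = (mdeg b).+1.
Proof.
rewrite /mdeg (eq_bigr (fun j => (i == j) + b j)%N) => [|j _]; last by rewrite ffunE.
by rewrite big_split /= (bigD1 i) //= eqxx big1 // => j; rewrite eq_sym => /negPf->.
Qed.

(** Induction on the degree bound, removing the part of top degree with coefficients delta^a(w) /
    a!. *)
Lemma decomposition_exists n w :
  (forall b, (n <= mdeg b)%N -> delta_pow delta b w = 0) ->
  exists (r : seq {ffun 'I_s -> nat}) (c : {ffun 'I_s -> nat} -> A), [/\ uniq r,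
    forall a, a \in r -> (mdeg a < n)%N,
    forall a, a \in r -> invariants delta (c a)
    & w = \sum_(a <- r) phi a (c a)].
Proof.
elim: n w => [|n IH] w wn.
  (* At the zero multi-index the hypothesis says w = 0. *)
  exists [::], (fun=> 0); split=> //; rewrite big_nil -(wn [ffun=> 0%N]) //.
  rewrite delta_powE /seq_delta_pow; elim: (index_enum _) => [|i r IH].
    by rewrite big_nil.
  by rewrite big_cons /= ffunE.
pose c (a : {ffun 'I_s -> nat}) := alg_map A (\prod_(i < s) (a i)`!)%N%:R^-1 *
  delta_pow delta a w.
(* One more derivation raises the degree of a beyond n, where w is annihilated. *)
have cinv a : mdeg a = n -> invariants delta (c a).
  move=> an; apply: subalgebra_invariants.2; apply/invariantsP => i.
  by rewrite delta_powS wn // mdegS an.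
pose w' := w - \sum_(a <- multidegrees s n) phi a (c a).
have [b nb|r [c' [ur rn c'inv w'E]]] := IH w'.
  have -> : delta_pow delta b w' = delta_pow delta b w -
      \sum_(a <- multidegrees s n) delta_pow delta b (phi a (c a)).
    rewrite -delta_pow_sum; set z := \sum_(a <- _) _.
    apply: (addIr (delta_pow delta b z)).
    by rewrite -seq_delta_powD !subrK.
  have sumE : \sum_(a <- multidegrees s n) delta_pow delta b (phi a (c a)) =
      \sum_(a <- multidegrees s n) if b == a then delta_pow delta b w else 0.
    apply: eq_big_seq => a; rewrite mem_multidegrees => /eqP an.
    rewrite phi_delta ?an //; last exact: cinv.
    case: eqP => // ->; rewrite /c mulrA -commr_nat -mulrA.
    exact: alg_map_natVK.
  rewrite sumE; move: nb; rewrite leq_eqVlt => /predU1P[bn|bn].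
    rewrite (bigD1_seq b) ?multidegrees_uniq ?mem_multidegrees ?bn //=.
    by rewrite eqxx big1 ?addr0 ?subrr // => a; rewrite eq_sym => /negPf->.
  by rewrite wn // big1 ?subr0 // => a _; case: ifP.
exists (r ++ multidegrees s n), (fun a => if mdeg a == n then c a else c' a); split.
- rewrite cat_uniq ur multidegrees_uniq andbT; apply/hasPn => a.
  by rewrite mem_multidegrees => /eqP an; apply/negP => /rn; rewrite an ltnn.
- move=> a; rewrite mem_cat mem_multidegrees => /orP[/rn/ltnW//|/eqP->//].
- move=> a; rewrite mem_cat mem_multidegrees; case: eqP => [an _|_]; first exact: cinv.
  by rewrite orbF; apply: c'inv.
- rewrite big_cat /= -[LHS](subrK (\sum_(a <- multidegrees s n) phi a (c a))).
  rewrite -/w' w'E; congr (_ + _); apply: eq_big_seq => a.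
    by move=> /rn an; rewrite ltn_eqF.
  by rewrite mem_multidegrees => ->.
Qed.

(** Descending induction on the degree of a: after applying delta^a, terms of higher degree vanish
    by induction and the others by [phi_delta], leaving a! c(a) = 0. *)
Lemma decomposition_free (r : seq {ffun 'I_s -> nat}) c : uniq r ->
  (forall a, a \in r -> invariants delta (c a)) ->
  \sum_(a <- r) phi a (c a) = 0 -> forall a, a \in r -> c a = 0.
Proof.
move=> ur cinv sum0 a.
have [m mP] : exists m, forall a, a \in r -> (mdeg a < m)%N.
  by exists (\max_(a <- r) mdeg a).+1 => b br; rewrite ltnS leq_bigmax_seq.
have [k] := ubnP (m - mdeg a); elim: k a => // k IH a ak ar.
have := congr1 (delta_pow delta a) sum0.
rewrite delta_pow_sum (bigD1_seq a) //= phi_delta ?eqxx //; last exact: cinv.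
rewrite [X in _ + X]big_seq_cond [X in _ + X]big1.
  by rewrite addr0 delta_powE seq_delta_pow0 => /natr_mul_eq0; apply.
move=> b /andP[br ba].
have [bn|bn] := leqP (mdeg b) (mdeg a).
  by rewrite (phi_delta (cinv b br) bn) eq_sym (negPf ba).
rewrite (IH b) ?phi0 ?[delta_pow _ _ _]seq_delta_pow0 //.
by rewrite (leq_trans (ltn_sub2l (mP a ar) bn)).
Qed.

(** Common to [A] and the [N_ delta n]: each w needs a degree bound n such that all multi-indices of
    degree below n lie in [D]. *)
Lemma decomposition_direct_sum (D : set {ffun 'I_s -> nat}) (W : set A) :
  W 0 -> (forall a b, W a -> W b -> W (a + b)) ->
  (forall a b, D a -> invariants delta b -> W (phi a b)) ->
  (forall w, W w -> exists2 n, forall b, (n <= mdeg b)%N -> delta_pow delta b w = 0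
     & forall a, (mdeg a < n)%N -> D a) ->
  direct_sum D (fun a => [set phi a b | b in invariants delta]) W.
Proof.
have [subI _] := subalgebra_invariants.
move=> W0 WD phiW Wn; apply: direct_sum_criterion => //.
- by move=> a; exists 0; [exact: subring0|exact: phi0].
- move=> a _ _ [b bI <-] [b' b'I <-]; exists (b - b'); last exact: phiB.
  exact: subringB subI _ _ bI b'I.
- by move=> a Da _ [b bI <-]; apply: phiW.
- move=> w /Wn[n /decomposition_exists[r [c [ur rn cI wE]]] nD].
  exists r, (fun a => phi a (c a)); split=> // a ar; split; first exact/nD/rn.
  by exists (c a) => //; apply: cI.
- move=> r c ur DU sum0.
  (* Recovers the invariant coefficients from the summands, with 0 off the list. *)
  have /choice[c' c'P] (a : {ffun 'I_s -> nat}) :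
      exists b, a \in r -> invariants delta b /\ phi a b = c a.
    have [/DU[_ [b bI <-]]|_] := boolP (a \in r); last by exists 0.
    by exists b.
  have c'0 := decomposition_free ur (fun a ar => (c'P a ar).1) _.
  move=> a ar; rewrite -(c'P a ar).2 c'0 ?phi0 //.
  by rewrite -[RHS]sum0; apply: eq_big_seq => b br; rewrite (c'P b br).2.
Qed.

Lemma decomposition_N n : direct_sum [set a | (mdeg a <= n)%N]
  (fun a => [set phi a b | b in invariants delta]) (N_ delta n).
Proof.
apply: decomposition_direct_sum.
- by move=> b _; apply: seq_delta_pow0.
- move=> a b Na Nb c nc; rewrite delta_powE seq_delta_powD.
  by have := Na c nc; have := Nb c nc; rewrite !delta_powE => -> ->; rewrite addr0.
- move=> a b /= an bI c nc; rewrite (phi_delta bI (leq_trans an (ltnW nc))).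
  by case: eqP nc => // ->; rewrite ltnNge an.
(* The bound is n + 1 because [N_ delta n] constrains degrees strictly above n. *)
- by move=> w Nw; exists n.+1.
Qed.

Lemma decomposition_T : direct_sum [set: {ffun 'I_s -> nat}]
  (fun a => [set phi a b | b in invariants delta]) [set: A].
Proof.
apply: decomposition_direct_sum => // w _.
have : [set: A] w by []; rewrite -bigcup_N => -[n _ Nw].
by exists n.+1.
Qed.

End Decomposition.

Lemma delta_pow_monomialMr a b c : invariants delta c -> (mdeg a <= mdeg b)%N ->
  delta_pow delta b (monomial x a * c) =
  if b == a then (\prod_(i < s) (a i)`!)%:R * c else 0.
Proof.
move=> cI ab; rewrite delta_powE seq_delta_powMr // -delta_powE.
by rewrite delta_pow_monomial //; case: eqP; rewrite ?mul0r.
Qed.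

Lemma delta_pow_monomialMl a b c : invariants delta c -> (mdeg a <= mdeg b)%N ->
  delta_pow delta b (c * monomial x a) =
  if b == a then (\prod_(i < s) (a i)`!)%:R * c else 0.
Proof.
move=> cI ab; rewrite delta_powE seq_delta_powMl // -delta_powE.
by rewrite delta_pow_monomial //; case: eqP; rewrite ?mulr0 // commr_nat.
Qed.

End DualElements.

Theorem theorem2p3 (K : fieldType) (charK0 : [pchar K] =i pred0)
    (A : algebra K) (s : nat) (s_gt0 : (0 < s)%N) :
  ((exists (delta : 'I_s -> A -> A) (x : 'I_s -> A),
       commuting_lnd_with_dual_elements delta x)
   <->
   (exists (B : set A) (x : 'I_s -> A),
       [/\ iterated_ore_extension B x,
           forall i b, B b -> B (ad (x i) b)
         & forall i j, B (ad (x i) (x j))])) /\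
  (forall (delta : 'I_s -> A -> A) (x : 'I_s -> A),
     commuting_lnd_with_dual_elements delta x ->
     let Ad := invariants delta in
     let xA (alpha : {ffun 'I_s -> nat}) :=
       [set monomial x alpha * b | b in Ad] in
     let Ax (alpha : {ffun 'I_s -> nat}) :=
       [set b * monomial x alpha | b in Ad] in
     [/\ iterated_ore_extension Ad x,
         forall i b, Ad b -> Ad (ad (x i) b)
       & forall i j, Ad (ad (x i) (x j))] /\
     [/\ direct_sum [set: {ffun 'I_s -> nat}] xA [set: A],
         direct_sum [set: {ffun 'I_s -> nat}] Ax [set: A],
         \bigcup_i N_ delta i = [set: A],
         forall i : nat,
           direct_sum [set alpha | (mdeg alpha <= i)%N] xA (N_ delta i)
       & forall i : nat,
           direct_sum [set alpha | (mdeg alpha <= i)%N] Ax (N_ delta i)]).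
Proof.
have ore_invariants (delta : 'I_s -> A -> A) x :
    commuting_lnd_with_dual_elements delta x ->
    [/\ iterated_ore_extension (invariants delta) x,
        forall i b, invariants delta b -> invariants delta (ad (x i) b)
      & forall i j, invariants delta (ad (x i) (x j))].
  move=> dualP; split.
  - exact: (iterated_ore_extension_invariants charK0 dualP).
  - exact: invariants_ad.
  - exact: invariants_adx.
split.
  split=> [[delta [x dualP]]|[B [x [oreB adB adx]]]].
    by exists (invariants delta), x; apply: ore_invariants.
  have [delta dualP] := iterated_ore_lnd oreB adB adx.
  by exists delta, x.
move=> delta x dualP Ad xA Ax; split; first exact: ore_invariants.
(* These facts verify the hypotheses on [phi] for coefficients on the right and on the left. *)
have xB a b c : monomial x a * (b - c) = monomial x a * b - monomial x a * c.
  exact: mulrBr.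
have Bx a b c : (b - c) * monomial x a = b * monomial x a - c * monomial x a.
  exact: mulrBl.
have xd := delta_pow_monomialMr dualP; have dx := delta_pow_monomialMl dualP.
split.
- exact: (decomposition_T charK0 dualP xB xd).
- exact: (decomposition_T charK0 dualP Bx dx).
- exact: bigcup_N dualP.
- exact: (decomposition_N charK0 dualP xB xd).
- exact: (decomposition_N charK0 dualP Bx dx).
Qed.
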